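(* $\pi_e(\mathcal{Q}_2)=\pi_{ce}(B)\leq 0.60680$ and $\pi_e(C_6)=\pi_{ce}(B_1,B_2)\leq 0.37550$, where $\pi_e$, $\pi_{ce}$, $B$, $B_1$, $B_2$ are as defined in the context.
   Context: The $n$-dimensional hypercube $\mathcal{Q}_n$ is the graph with vertex set $\{0,1,\ldots,2^n-1\}$ in which $v_1v_2$ is an edge if and only if the binary representations of $v_1$ and $v_2$ differ in exactly one digit. For a family of graphs $\mathcal{F}$, a graph is $\mathcal{F}$-free if it contains no subgraph isomorphic to a member of $\mathcal{F}$. The edge Tur\'an density is $\pi_e(\mathcal{F})=\lim_{n\to\infty}\max\{|E(G)|/|E(\mathcal{Q}_n)| : G\subseteq \mathcal{Q}_n \text{ is } \mathcal{F}\text{-free}\}$ (this limit exists). $C_6$ is the cycle on $6$ vertices. An edge-coloured hypercube $(n,\kappa)_e$ is $\mathcal{Q}_n$ together with $\kappa:E(\mathcal{Q}_n)\to\{\text{red},\text{blue}\}$. For $F_1=(n_1,\kappa_1)_e$, $F_2=(n_2,\kappa_2)_e$: $F_1$ is isomorphic to $F_2$ if there is a bijection $f:V(\mathcal{Q}_{n_1})\to V(\mathcal{Q}_{n_2})$ such that every edge $v_1v_2$ of $\mathcal{Q}_{n_1}$ maps to an edge $f(v_1)f(v_2)$ with $\kappa_1(v_1v_2)=\kappa_2(f(v_1)f(v_2))$; $F_1$ is a subcube of $F_2$ if there is an injection $g:V(\mathcal{Q}_{n_1})\to V(\mathcal{Q}_{n_2})$ mapping edges to edges such that blue edges map to blue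 edges. For a family $\mathcal{F}$ of edge-coloured hypercubes, $H$ is $\mathcal{F}$-free if it has no subcube isomorphic to a member of $\mathcal{F}$. The edge density $d_e((n,\kappa)_e)$ is the fraction of edges coloured blue, and $\pi_{ce}(\mathcal{F})=\lim_{n\to\infty}\max_\kappa\{d_e((n,\kappa)_e): (n,\kappa)_e\text{ is } \mathcal{F}\text{-free}\}$ (this limit exists). $B$ is $\mathcal{Q}_2$ with all four edges blue. $B_1$ is $\mathcal{Q}_3$ with the edges $01,13,32,26,64,40$ blue and all other edges red; $B_2$ is $\mathcal{Q}_3$ with the edges $51,13,32,26,64,45$ blue and all other edges red. *)

(* Defs.v *)
From HB Require Import structures.
From mathcomp Require Import all_boot all_order all_algebra.
From mathcomp Require Import all_classical all_reals all_analysis.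

Set Implicit Arguments.
Unset Strict Implicit.
Unset Printing Implicit Defensive.

Import Order.TTheory GRing.Theory Num.Theory.
Import numFieldNormedType.Exports.

Local Open Scope ring_scope.

Record sgraph := SGraph {
  vertex :> finType;
  adj : rel vertex;
  adj_sym : symmetric adj;
  adj_irr : irreflexive adj
}.

Definition edges (G : sgraph) : {set {set G}} :=
  [set e | [exists x, exists y, adj x y && (e == [set x; y]%SET)]]%SET.

Definition giso (G H : sgraph) : Prop :=
  exists2 f : G -> H, bijective f & forall x y, adj (f x) (f y) = adj x y.

(* A subgraph of G is given by its vertex set and its edge set. *)
Definition presub (G : sgraph) : finType := ({set G} * {set {set G}})%type.

Definition is_subgraph (G : sgraph) (S : presub G) : bool :=
  (S.2 \subset edges G) && (finset.cover S.2 \subset S.1).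

(* The conjunct [val x != val y] only serves to make the definition total: it
   is redundant when [is_subgraph S] holds. *)
Definition sub_adj (G : sgraph) (S : presub G) : rel {x : G | x \in S.1} :=
  fun x y => (val x != val y) && ([set val x; val y]%SET \in S.2).

Lemma sub_adj_sym (G : sgraph) (S : presub G) : symmetric (@sub_adj G S).
Proof. by move=> x y; rewrite /sub_adj eq_sym finset.setUC. Qed.

Lemma sub_adj_irr (G : sgraph) (S : presub G) : irreflexive (@sub_adj G S).
Proof. by move=> x; rewrite /sub_adj eqxx. Qed.

Definition subgraph (G : sgraph) (S : presub G) : sgraph :=
  SGraph (@sub_adj_sym G S) (@sub_adj_irr G S).

(* The family is not typed as [set sgraph], whose universe constraints are
   inconsistent with those of the library. *)
Definition gfree (F : sgraph -> Prop) (G : sgraph) : Prop :=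
  ~ exists S : presub G,
      is_subgraph S /\ exists H : sgraph, F H /\ giso (subgraph S) H.

Definition bit (v k : nat) : bool := odd (v %/ 2 ^ k)%N.

Definition cube_adj (n : nat) : rel 'I_(2 ^ n) :=
  fun x y => #|[set k : 'I_n | bit x k != bit y k]%SET| == 1%N.

Lemma cube_adj_sym n : symmetric (@cube_adj n).
Proof.
move=> x y; rewrite /cube_adj; congr (#|pred_of_set _| == _).
by apply/finset.setP => k; rewrite !inE eq_sym.
Qed.

Lemma cube_adj_irr n : irreflexive (@cube_adj n).
Proof.
move=> x; rewrite /cube_adj (_ : [set k | _]%SET = finset.set0) ?cards0 //.
by apply/finset.setP => k; rewrite !inE eqxx.
Qed.

Definition Q (n : nat) : sgraph := SGraph (@cube_adj_sym n) (@cube_adj_irr n).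

Definition C6_adj : rel 'I_6 := fun i j => (j == ordS i) || (i == ordS j).

Lemma C6_adj_sym : symmetric C6_adj.
Proof. by move=> i j; rewrite /C6_adj orbC. Qed.

Lemma C6_adj_irr : irreflexive C6_adj.
Proof. by case=> [[|[|[|[|[|[|i]]]]]] hi]. Qed.

Definition C6 : sgraph := SGraph C6_adj_sym C6_adj_irr.

(* Only values at n >= 1 are meaningful: Q 0 has no edge. *)
Definition ex_density (R : realType) (F : sgraph -> Prop) (n : nat) : R :=
  \big[Num.max/0]_(S : presub (Q n) | is_subgraph S && `[< gfree F (subgraph S) >])
    (#|S.2|%:R / #|edges (Q n)|%:R).

Definition pi_e (R : realType) (F : sgraph -> Prop) : R := limn (ex_density R F).

Notation colour := bool (only parsing).
Definition blue : colour := true.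
Definition red : colour := false.

Definition edge (G : sgraph) : finType := {e : {set G} | e \in edges G}.

Lemma mem_edges (G : sgraph) (x y : G) : adj x y -> [set x; y]%SET \in edges G.
Proof.
move=> h; rewrite inE; apply/existsP; exists x; apply/existsP; exists y.
by rewrite h eqxx.
Qed.

Definition mkedge (G : sgraph) (x y : G) (h : adj x y) : edge G :=
  exist _ [set x; y]%SET (mem_edges h).

Record ecube := ECube { dim : nat; col : {ffun edge (Q dim) -> colour} }.

Definition ecube_iso (F1 F2 : ecube) : Prop :=
  exists2 f : Q (dim F1) -> Q (dim F2), bijective f &
    forall (x y : Q (dim F1)) (h : adj x y),
      exists h' : adj (f x) (f y), col F1 (mkedge h) = col F2 (mkedge h').

Definition subcube (F1 F2 : ecube) : Prop :=
  exists2 g : Q (dim F1) -> Q (dim F2), injective g &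
    forall (x y : Q (dim F1)) (h : adj x y),
      exists h' : adj (g x) (g y),
        col F1 (mkedge h) = blue -> col F2 (mkedge h') = blue.

Definition cfree (F : set ecube) (H : ecube) : Prop :=
  ~ exists K : ecube, subcube K H /\ exists M : ecube, F M /\ ecube_iso K M.

Definition d_e (R : realType) (H : ecube) : R :=
  #|[set e | col H e == blue]%SET|%:R / #|edges (Q (dim H))|%:R.

Definition ex_cdensity (R : realType) (F : set ecube) (n : nat) : R :=
  \big[Num.max/0]_(k : {ffun edge (Q n) -> colour} | `[< cfree F (ECube k) >])
    d_e R (ECube k).

Definition pi_ce (R : realType) (F : set ecube) : R := limn (ex_cdensity R F).

(* The pair {a, b} as a set of vertices of Q n. *)
Definition vpair (n a b : nat) : {set Q n} :=
  [set v : 'I_(2 ^ n) | (v == a :> nat) || (v == b :> nat)]%SET.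

Definition ecube_of_blue (n : nat) (s : seq (nat * nat)) : ecube :=
  @ECube n [ffun e => if has (fun p => val e == vpair n p.1 p.2) s
                      then blue else red].

Definition B : ecube := @ECube 2 [ffun=> blue].

Definition B1 : ecube :=
  ecube_of_blue 3 [:: (0, 1); (1, 3); (3, 2); (2, 6); (6, 4); (4, 0)]%N.

Definition B2 : ecube :=
  ecube_of_blue 3 [:: (5, 1); (1, 3); (3, 2); (2, 6); (6, 4); (4, 5)]%N.

(* Main.v *)
Require Import Defs.
From Stdlib Require Import ZArith.
From HB Require Import structures.
From mathcomp Require Import all_boot all_order all_algebra.
From mathcomp Require Import all_classical all_reals all_analysis.
From mathcomp Require Import zify ssrZ ring.

(** Flag algebras on the 3-dimensional cube.  Fix a blue/red colouring of the
    edges of the n-cube.  For an edge [{v, v + d}] and another direction [i],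
    the flag at [i] records the colours of the three other edges of the square
    spanned by [d] and [i] at [v].  For a positive semidefinite kernel [K] on
    flags, depending on the colour of the edge, the sum of [K(flag i, flag j)]
    over all [i] and [j] is nonnegative; dropping the [n - 1] diagonal terms
    costs [O(n)] out of [n^2].  Summing over all edges and grouping by the
    3-dimensional subcubes spanned by [d, i, j], it suffices that in every
    square-free (resp. hexagon-free) colouring of the 3-cube, the number of blue
    edges plus the sum of [K] over the twelve edges is at most twelve times the
    claimed density, which is a finite check.  In a hexagon-free colouring an
    edge has at most one flag consisting of three blue edges, because two of them
    form a hexagon, so such flags are negligible and may be charged an
    arbitrarily large penalty.

    For the equality of the two densities: an injective edge-preserving map of a
    cube is a subcube, every 4-cycle of the n-cube spans a 2-dimensional subcube,
    and every 6-cycle spans a 3-dimensional one in which it is placed as in [B1]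
    or as in [B2]. *)

Set Implicit Arguments.
Unset Strict Implicit.
Unset Printing Implicit Defensive.

Import Order.TTheory GRing.Theory Num.Theory.
Import numFieldNormedType.Exports.
Local Open Scope ring_scope.

(** * Flags and certificates *)

(* A flag is encoded by the number with binary digits [b2 b1 b0]; the code [7]
   is the flag with three blue edges. *)
Definition flag_code (b0 b1 b2 : bool) : nat :=
  if b2 then (if b1 then (if b0 then 7 else 6) else (if b0 then 5 else 4))
  else (if b1 then (if b0 then 3 else 2) else (if b0 then 1 else 0)).

(* The twelve booleans are the colours of the edges of the cube at [v] spanned
   by [d, i, j]: [a0, a1, a2, a3] those of the edges in direction [d] at [v],
   [v + i], [v + j], [v + i + j]; [b0, b1, b2, b3] in direction [i] at [v],
   [v + d], [v + j], [v + d + j]; and [e0, e1, e2, e3] in direction [j] at [v],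
   [v + d], [v + i], [v + d + i]. *)
Definition local_sum (T : bool -> nat -> nat -> Z)
    (a0 a1 a2 a3 b0 b1 b2 b3 e0 e1 e2 e3 : bool) : Z :=
  let f := flag_code in
  foldr Z.add Z0
    [:: T a0 (f b0 b1 a1) (f e0 e1 a2); T a1 (f b0 b1 a0) (f e2 e3 a3);
        T a2 (f b2 b3 a3) (f e0 e1 a0); T a3 (f b2 b3 a2) (f e2 e3 a1);
        T b0 (f a0 a1 b1) (f e0 e2 b2); T b1 (f a0 a1 b0) (f e1 e3 b3);
        T b2 (f a2 a3 b3) (f e0 e2 b0); T b3 (f a2 a3 b2) (f e1 e3 b1);
        T e0 (f a0 a2 e1) (f b0 b2 e2); T e1 (f a0 a2 e0) (f b1 b3 e3);
        T e2 (f a1 a3 e3) (f b0 b2 e0); T e3 (f a1 a3 e2) (f b1 b3 e1)].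

Definition square_free (a0 a1 a2 a3 b0 b1 b2 b3 e0 e1 e2 e3 : bool) : bool :=
  ~~ [|| [&& a0, a1, b0 & b1], [&& a2, a3, b2 & b3], [&& a0, a2, e0 & e1],
         [&& a1, a3, e2 & e3], [&& b0, b2, e0 & e2] | [&& b1, b3, e1 & e3]].

(** The first twelve cycles run around two adjacent squares, one for each common edge; the last four
    miss two antipodal vertices. *)
Definition hexagon_free (a0 a1 a2 a3 b0 b1 b2 b3 e0 e1 e2 e3 : bool) : bool :=
  let f b0 b1 b2 b3 b4 b5 := [&& b0, b1, b2, b3, b4 & b5] in
  ~~ [|| f b0 b1 a1 e0 e1 a2, f b0 b1 a0 e2 e3 a3,
         f b2 b3 a3 e0 e1 a0, f b2 b3 a2 e2 e3 a1,
         f a0 a1 b1 e0 e2 b2, f a0 a1 b0 e1 e3 b3,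
         f a2 a3 b3 e0 e2 b0, f a2 a3 b2 e1 e3 b1,
         f a0 a2 e1 b0 b2 e2, f a0 a2 e0 b1 b3 e3,
         f a1 a3 e3 b0 b2 e0, f a1 a3 e2 b1 b3 e1,
         f a1 a2 b1 b2 e1 e2, f a1 a2 b0 b3 e0 e3,
         f a0 a3 b1 b2 e3 e0 | f a3 a0 b3 b0 e1 e2].

Definition all_bool (P : bool -> bool) := P true && P false.

Lemma all_boolP P b : all_bool P -> P b.
Proof. by case: b => /andP[]. Qed.

Definition all_colourings (P : bool -> bool -> bool -> bool -> bool -> bool ->
    bool -> bool -> bool -> bool -> bool -> bool -> bool) : bool :=
  all_bool (fun a0 => all_bool (fun a1 => all_bool (fun a2 => all_bool (fun a3 =>
  all_bool (fun b0 => all_bool (fun b1 => all_bool (fun b2 => all_bool (fun b3 =>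
  all_bool (fun e0 => all_bool (fun e1 => all_bool (fun e2 => all_bool (fun e3 =>
  P a0 a1 a2 a3 b0 b1 b2 b3 e0 e1 e2 e3)))))))))))).

Lemma all_colouringsP P : all_colourings P ->
  forall a0 a1 a2 a3 b0 b1 b2 b3 e0 e1 e2 e3,
  P a0 a1 a2 a3 b0 b1 b2 b3 e0 e1 e2 e3.
Proof.
rewrite /all_colourings.
by do 12 (let b := fresh "b" in
          intros H b; apply (@all_boolP _ b) in H; revert H).
Qed.

(** A sum of rank-one kernels, hence positive semidefinite whatever the integers in [fs]: rounding
    cannot spoil positivity. The [foldr] form computes; [gramE] turns it into a sum. *)
Definition gram (fs : seq (seq Z)) (f g : nat) : Z :=
  foldr (fun l s => l`_f * l`_g + s) 0 fs.

Lemma gramE fs f g : gram fs f g = \sum_(l <- fs) l`_f * l`_g.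
Proof. by elim: fs => [|l fs IH]; rewrite ?big_nil ?big_cons -?IH. Qed.

(** [W] rewards a blue edge, and [L] penalises each flag with three blue edges. *)
Definition kernel (W L : Z) (fs : bool -> seq (seq Z)) (b : bool) (f g : nat) : Z :=
  W *+ b + gram (fs b) f g - L *+ ((f == 7) + (g == 7)).

Lemma flag_code_lt8 b0 b1 b2 : (flag_code b0 b1 b2 < 8)%N.
Proof. by case: b0; case: b1; case: b2. Qed.

Lemma gram_le_forms (fs : bool -> seq (seq Z)) M :
  all_bool (fun x => all (fun f => gram (fs x) f f <= M) (iota 0 8)) ->
  forall x f, (f < 8)%N -> gram (fs x) f f <= M.
Proof.
by move=> H x f f8; move/(@all_boolP _ x)/allP: H; apply; rewrite mem_iota.
Qed.

(* The key [%Z] is taken by [int]. *)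
Delimit Scope Z_scope with cZ.

(* Both families of forms are rounded Cholesky factors of a numerical solution
   of the corresponding semidefinite program, scaled so that a blue edge weighs
   [square_weight], resp. [hexagon_weight]. *)

Definition square_forms (b : bool) : seq (seq Z) :=
  (if b then
    [:: [:: 38350; 6488; 6488; -27766; 242; 8994; 8994; 0];
        [:: 0; 89; 89; 1124; 14286; -852; -852; 0];
        [:: 0; 44; 44; 0; 1893; -58; -58; 0];
        [:: 0; 30; 30; 0; 0; -10; -10; 0];
        [:: 0; 0; 0; 0; 0; 17; 17; 0];
        [:: 0; 27131; -27131; 0; 0; 10656; -10656; 0];
        [:: 0; 0; 0; 0; 0; 7099; -7099; 0]]
  else
    [:: [:: 23367; -16780; -16780; -24267; 11576; -8195; -8195; 2388];
        [:: 0; 9474; 9474; 3940; 5305; 5476; 5476; -7824];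
        [:: 0; 1802; 1802; 0; 873; 714; 714; -1094];
        [:: 0; -297; -297; 0; 0; -159; -159; 219];
        [:: 0; 211; 211; 0; 0; -20; -20; 0];
        [:: 0; 0; 0; 0; 0; 26; 26; 0];
        [:: 0; 37061; -37061; 0; 0; 21670; -21670; 0];
        [:: 0; 0; 0; 0; 0; 14631; -14631; 0]])%cZ.

Definition hexagon_forms (b : bool) : seq (seq Z) :=
  (if b then
    [:: [:: 30962; -10266; -10266; 0; 28006; 0; 0; 0];
        [:: 0; 0; 0; 0; 5723; 0; 0; 0];
        [:: 0; 24157; -24157; 0; 0; 0; 0; 0]]
  else
    [:: [:: 24511; -5798; -5798; -41229; 34155; -12869; -12869; 0];
        [:: 0; 3640; 3640; 10467; 15070; -7410; -7410; 0];
        [:: 0; 3589; 3589; 0; 14861; -7307; -7307; 0];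
        [:: 0; 28243; -28243; 0; 0; 427; -427; 0];
        [:: 0; 0; 0; 0; 0; 36893; -36893; 0]])%cZ.

Definition square_weight : Z := 900000000%cZ.
Definition hexagon_weight : Z := 1600000000%cZ.

Definition square_kernel := kernel square_weight 0%cZ square_forms.
Definition hexagon_kernel :=
  kernel hexagon_weight (7 * hexagon_weight)%cZ hexagon_forms.

(** The check over all colourings meets only 128 kernel values, computed once here. *)
Definition tabulate (T : bool -> nat -> nat -> Z) : seq (seq (seq Z)) :=
  [seq [seq [seq T b f g | g <- iota 0 8] | f <- iota 0 8] | b <- [:: false; true]].

Definition lookup (t : seq (seq (seq Z))) (b : bool) (f g : nat) : Z :=
  nth Z0 (nth [::] (nth [::] t b) f) g.

Lemma lookup_tabulate T b f g : (f < 8)%N -> (g < 8)%N ->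
  lookup (tabulate T) b f g = T b f g.
Proof.
move=> f8 g8; rewrite /lookup (nth_map false); last by case: b.
rewrite (nth_map 0%N) ?size_iota // (nth_map 0%N) ?size_iota // !nth_iota //.
by case: b.
Qed.

Lemma local_sum_tabulate T a0 a1 a2 a3 b0 b1 b2 b3 e0 e1 e2 e3 :
  local_sum (lookup (tabulate T)) a0 a1 a2 a3 b0 b1 b2 b3 e0 e1 e2 e3 =
  local_sum T a0 a1 a2 a3 b0 b1 b2 b3 e0 e1 e2 e3.
Proof. by rewrite /local_sum !lookup_tabulate ?flag_code_lt8. Qed.

Definition local_check T (b : Z) P : bool :=
  let t := tabulate T in
  all_colourings (fun a0 a1 a2 a3 b0 b1 b2 b3 e0 e1 e2 e3 =>
    P a0 a1 a2 a3 b0 b1 b2 b3 e0 e1 e2 e3 ==>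
    Z.leb (local_sum (lookup t) a0 a1 a2 a3 b0 b1 b2 b3 e0 e1 e2 e3) (12 * b)%cZ).

(** The constant is 1517/2500 of [square_weight]; in the next check it is 751/2000 of
    [hexagon_weight]. *)
Lemma square_local_check : local_check square_kernel (1517 * 360000)%cZ square_free.
Proof. by vm_compute. Qed.

Lemma hexagon_local_check : local_check hexagon_kernel (751 * 800000)%cZ hexagon_free.
Proof. by vm_compute. Qed.

Lemma local_checkP T b P a0 a1 a2 a3 b0 b1 b2 b3 e0 e1 e2 e3 : local_check T b P ->
  P a0 a1 a2 a3 b0 b1 b2 b3 e0 e1 e2 e3 ->
  local_sum T a0 a1 a2 a3 b0 b1 b2 b3 e0 e1 e2 e3 <= 12%:R * b.
Proof.
move=> /all_colouringsP/(_ a0 a1 a2 a3 b0 b1 b2 b3 e0 e1 e2 e3)/implyP H /H.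
by rewrite local_sum_tabulate.
Qed.

(** * Averaging over 3-dimensional subcubes *)

Section Averaging.

(** Averaging sees the cube only through its commuting involutions. [c v d] is the colour of the
    edge at [v] in direction [d], read from either end. *)
Variables (n : nat) (V : finType) (flip : 'I_n -> V -> V).
Hypothesis flipK : forall d, involutive (flip d).
Hypothesis flipC : forall d i v, flip d (flip i v) = flip i (flip d v).
Variable c : V -> 'I_n -> bool.
Hypothesis cflip : forall d v, c (flip d v) d = c v d.

Definition flag v d i := flag_code (c v i) (c (flip d v) i) (c (flip i v) d).

(** The vertex is summed innermost, so that a shift of [v] depending on the directions just
    reindexes that sum. *)
Definition triple_sum (F : V -> 'I_n -> 'I_n -> 'I_n -> Z) : Z :=
  \sum_d \sum_i \sum_j \sum_v (if uniq [:: d; i; j] then F v d i j else 0).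

Lemma flip_inj d : injective (flip d).
Proof. exact: inv_inj (flipK d). Qed.

Lemma triple_sumD F G :
  triple_sum (fun v d i j => F v d i j + G v d i j) = triple_sum F + triple_sum G.
Proof.
rewrite /triple_sum -big_split; apply: eq_bigr => d _ /=.
rewrite -big_split; apply: eq_bigr => i _ /=.
rewrite -big_split; apply: eq_bigr => j _ /=.
rewrite -big_split; apply: eq_bigr => v _ /=.
by case: ifP => // _; rewrite addr0.
Qed.

Lemma triple_sum_shift (g : 'I_n -> 'I_n -> 'I_n -> V -> V) F :
  (forall d i j, injective (g d i j)) ->
  triple_sum (fun v d i j => F (g d i j v) d i j) = triple_sum F.
Proof.
move=> g_inj; rewrite /triple_sum.
apply: eq_bigr => d _; apply: eq_bigr => i _; apply: eq_bigr => j _.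
by rewrite [RHS](reindex_inj (g_inj d i j)).
Qed.

Lemma triple_sum_swap F :
  triple_sum (fun v d i j => F v i d j) = triple_sum F.
Proof.
rewrite /triple_sum exchange_big.
apply: eq_bigr => d _; apply: eq_bigr => i _; apply: eq_bigr => j _.
apply: eq_bigr => v _; congr (if _ then _ else _).
by rewrite /= !inE (eq_sym i d); do ![case: (_ == _) => //=].
Qed.

Lemma triple_sum_rot F :
  triple_sum (fun v d i j => F v j d i) = triple_sum F.
Proof.
rewrite /triple_sum; under eq_bigr => d _ do rewrite exchange_big.
rewrite exchange_big /=.
apply: eq_bigr => d _; apply: eq_bigr => i _; apply: eq_bigr => j _.
apply: eq_bigr => v _; congr (if _ then _ else _).
by rewrite /= !inE (eq_sym i d) (eq_sym j d); do ![case: (_ == _) => //=].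
Qed.

Lemma triple_sum_le F G :
  (forall v d i j, uniq [:: d; i; j] -> F v d i j <= G v d i j) ->
  triple_sum F <= triple_sum G.
Proof.
move=> FG; apply: ler_sum => d _; apply: ler_sum => i _; apply: ler_sum => j _.
by apply: ler_sum => v _; case: ifP => // /FG.
Qed.

Lemma sum_neq (d : 'I_n) : \sum_i (if i != d then 1 else 0 : Z) = n%:R - 1.
Proof.
have -> : n%:R = \sum_(i < n) 1 :> Z by rewrite sumr_const card_ord.
rewrite (bigD1 d) //= eqxx add0r [in RHS](bigD1 d) //=.
by rewrite addrAC subrr add0r; apply: eq_bigr => i ->.
Qed.

(** Each pair (v, d) extends to (n - 1)(n - 2) frames; in [Z] the subtractions are not truncated. *)
Lemma triple_sum_fst (F : V -> 'I_n -> Z) :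
  triple_sum (fun v d _ _ => F v d) =
  (n%:R - 1) * (n%:R - 2%:R) * \sum_d \sum_v F v d.
Proof.
rewrite /triple_sum mulr_sumr; apply: eq_bigr => d _.
transitivity (\sum_(i < n) (if i != d then 1 else 0 : Z) *
                ((n%:R - 2%:R) * \sum_v F v d)); last first.
  by rewrite -mulr_suml sum_neq mulrA.
apply: eq_bigr => i _.
case: (eqVneq i d) => [->|nid]; rewrite /= ?mul0r ?mul1r.
  by apply: big1 => j _; apply: big1 => v _; rewrite /= !inE eqxx.
transitivity (\sum_(j < n) ((if j != d then 1 else 0 : Z) - (if j == i then 1 else 0)) *
                \sum_v F v d).
  apply: eq_bigr => j _; rewrite mulr_sumr; apply: eq_bigr => v _.
  rewrite /= !inE (eq_sym d i) (negPf nid) (eq_sym d j) (eq_sym i j) /= andbT.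
  case: (eqVneq j i) => [->|_]; first by rewrite /= andbF nid subrr mul0r.
  by rewrite subr0 andbT; case: (j == d); rewrite ?mul0r ?mul1r.
rewrite -mulr_suml sumrB sum_neq -big_mkcond big_pred1_eq.
by congr (_ * _); ring.
Qed.

Definition stat (T : bool -> nat -> nat -> Z) v d i j :=
  T (c v d) (flag v d i) (flag v d j).

(* Rewrites every vertex of the cube spanned by [d, i, j] to the form
   [flip d (flip i (flip j v))], dropping the flip along the edge itself. *)
Lemma flip_norm d i j :
  ((forall x, flip i (flip d x) = flip d (flip i x)) *
   (forall x, flip j (flip d x) = flip d (flip j x)) *
   (forall x, flip j (flip i x) = flip i (flip j x)) *
   (forall d x, flip d (flip d x) = x) *
   (forall d x, c (flip d x) d = c x d) *
   (forall x, c (flip d (flip i x)) i = c (flip d x) i) *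
   (forall x, c (flip d (flip j x)) j = c (flip d x) j) *
   (forall x, c (flip i (flip j x)) j = c (flip i x) j) *
   (forall x, c (flip d (flip i (flip j x))) j = c (flip d (flip i x)) j))%type.
Proof.
do !split=> *; rewrite ?flipK ?cflip //.
- by rewrite flipC cflip.
- by rewrite flipC cflip.
- by rewrite flipC cflip.
- by rewrite (flipC i) (flipC d) cflip.
Qed.

(* Every edge of a 3-dimensional subcube is the first edge [v, flip d v] of the
   same number of frames [(v, d, i, j)], so the sum over the frames of one term
   is a twelfth of the sum of the local sums. *)
Lemma triple_sum_local (T : bool -> nat -> nat -> Z) (b : Z) :
  (forall v d i j, uniq [:: d; i; j] ->
    local_sum T (c v d) (c (flip i v) d) (c (flip j v) d) (c (flip i (flip j v)) d)
      (c v i) (c (flip d v) i) (c (flip j v) i) (c (flip d (flip j v)) i)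
      (c v j) (c (flip d v) j) (c (flip i v) j) (c (flip d (flip i v)) j) <= 12%:R * b) ->
  triple_sum (stat T) <= triple_sum (fun _ _ _ _ => b).
Proof.
move=> Tb.
set S := stat T.
have inj2 d i : injective (fun v => flip d (flip i v)).
  by move=> x y /flip_inj /flip_inj.
have S12 : 12%:R * triple_sum S = triple_sum (fun v d i j =>
   S v d i j + (S (flip i v) d i j + (S (flip j v) d i j + (S (flip i (flip j v)) d i j +
   (S v i d j + (S (flip d v) i d j + (S (flip j v) i d j + (S (flip d (flip j v)) i d j +
   (S v j d i + (S (flip d v) j d i + (S (flip i v) j d i +
    S (flip d (flip i v)) j d i))))))))))).
  (* Each of the twelve terms is [S] after a permutation of the directions and a shift of the
     vertex, neither of which changes the triple sum. *)
  rewrite !triple_sumD (triple_sum_swap S) (triple_sum_rot S).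
  rewrite (triple_sum_shift (g := fun d i j => flip i) S);
    last by move=> *; exact: flip_inj.
  rewrite (triple_sum_shift (g := fun d i j => flip j) S);
    last by move=> *; exact: flip_inj.
  rewrite (triple_sum_shift (g := fun d i j v => flip i (flip j v)) S);
    last by move=> *; exact: inj2.
  rewrite (triple_sum_swap (fun v d i j => S (flip i v) d i j)).
  rewrite (triple_sum_swap (fun v d i j => S (flip j v) d i j)).
  rewrite (triple_sum_swap (fun v d i j => S (flip i (flip j v)) d i j)).
  rewrite (triple_sum_rot (fun v d i j => S (flip i v) d i j)).
  rewrite (triple_sum_rot (fun v d i j => S (flip j v) d i j)).
  rewrite (triple_sum_rot (fun v d i j => S (flip i (flip j v)) d i j)).
  rewrite (triple_sum_shift (g := fun d i j => flip i) S);
    last by move=> *; exact: flip_inj.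
  rewrite (triple_sum_shift (g := fun d i j => flip j) S);
    last by move=> *; exact: flip_inj.
  rewrite (triple_sum_shift (g := fun d i j v => flip i (flip j v)) S);
    last by move=> *; exact: inj2.
  by ring.
rewrite -(ler_pM2l (x := 12%:R)) // S12.
have -> : 12%:R * triple_sum (fun _ _ _ _ => b) = triple_sum (fun _ _ _ _ => 12%:R * b).
  have sum_cst x : \sum_(d < n) \sum_(v : V) x = x * (#|V| * n)%:R :> Z.
    by under eq_bigr do rewrite sumr_const; rewrite sumr_const card_ord -mulrnA mulr_natr.
  rewrite (triple_sum_fst (fun _ _ => b)) (triple_sum_fst (fun _ _ => 12%:R * b)).
  by rewrite !sum_cst; ring.
apply: triple_sum_le => v d i j u; apply: le_trans (Tb v d i j u).
rewrite /local_sum -[Z.add]/(@GRing.add Z) -[Z0]/(0 : Z) /= /S /stat /flag.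
by rewrite !(flip_norm d i j) addr0.
Qed.

(** Restores the diagonal, since positivity applies only to the full sum over pairs of directions
    other than [d]. *)
Lemma sum_uniq (d : 'I_n) (F : 'I_n -> 'I_n -> Z) :
  \sum_i \sum_j (if uniq [:: d; i; j] then F i j else 0) =
  \sum_i \sum_j (i != d)%:R * (j != d)%:R * F i j - \sum_i (i != d)%:R * F i i.
Proof.
rewrite -sumrB; apply: eq_bigr => i _.
rewrite (bigD1 i) //= !inE eqxx /= andbF add0r [in RHS](bigD1 i) //=.
rewrite -natrM mulnb andbb addrAC subrr add0r; apply: eq_bigr => j nji.
rewrite !inE (eq_sym d) (eq_sym d j) (eq_sym i j) nji andbT -natrM mulnb.
by case: (i == d); case: (j == d); rewrite ?mul1r ?mul0r.
Qed.

(** The double sum is a sum of squares, one for each linear form in [fs]. *)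
Lemma gram_sum_ge0 fs (w : 'I_n -> Z) (h : 'I_n -> nat) :
  0 <= \sum_i \sum_j w i * w j * gram fs (h i) (h j).
Proof.
have -> : \sum_i \sum_j w i * w j * gram fs (h i) (h j) =
          \sum_(l <- fs) (\sum_i w i * l`_(h i)) ^+ 2.
  under eq_bigr do under eq_bigr do rewrite gramE mulr_sumr.
  under eq_bigr do rewrite exchange_big /=.
  rewrite exchange_big /=; apply: eq_bigr => l _.
  rewrite expr2 mulr_suml; apply: eq_bigr => i _.
  by rewrite mulr_sumr; apply: eq_bigr => j _; rewrite mulrACA.
by apply: sumr_ge0 => l _; apply: sqr_ge0.
Qed.

Lemma flag_lt8 v d i : (flag v d i < 8)%N.
Proof. exact: flag_code_lt8. Qed.

Lemma sum_neqE (d : 'I_n) : \sum_i (i != d)%:R = n%:R - 1 :> Z.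
Proof. by rewrite -(sum_neq d); apply: eq_bigr => i _; case: (i != d). Qed.

(** The full quadratic form is nonnegative, and each of the n - 1 diagonal terms removed from it is
    at most [M]. *)
Lemma gram_sum_ge fs M v d : (forall f, (f < 8)%N -> gram fs f f <= M) ->
  - ((n%:R - 1) * M) <= \sum_i \sum_j
    (if uniq [:: d; i; j] then gram fs (flag v d i) (flag v d j) else 0).
Proof.
move=> fsM; rewrite sum_uniq -[leLHS]add0r lerB //.
  exact: (gram_sum_ge0 fs (fun i => (i != d)%:R)).
rewrite -(sum_neqE d) mulr_suml; apply: ler_sum => i _.
by apply: ler_wpM2l => //; apply/fsM/flag_lt8.
Qed.

(** At most one direction [i0] carries the flag 7, so each of the two indicators is nonzero on at
    most n - 1 pairs. *)
Lemma flag7_sum_le v d :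
  (forall i j, uniq [:: d; i; j] -> ~~ ((flag v d i == 7) && (flag v d j == 7))) ->
  \sum_i \sum_j (if uniq [:: d; i; j]
     then ((flag v d i == 7) + (flag v d j == 7))%:R else 0) <= 2%:R * (n%:R - 1) :> Z.
Proof.
move=> f7.
have [i0 fi0] : exists i0, forall i, i != d -> flag v d i == 7 -> i == i0.
  case: (pickP (fun i => (i != d) && (flag v d i == 7))) => [i0 /andP[i0d fi0]|no].
    exists i0 => i id fi; apply: contraTT isT => ii0.
    have := f7 i i0; rewrite fi fi0 /= !inE (eq_sym d) (negPf id) (eq_sym d) (negPf i0d).
    by rewrite (negPf ii0) => /(_ isT).
  (* Without such a direction, [d] serves as a default. *)
  by exists d => i id fi; have := no i; rewrite id fi.
have -> : 2%:R * (n%:R - 1) = \sum_i \sum_j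
    ((i == i0)%:R * (j != d)%:R + (i != d)%:R * (j == i0)%:R) :> Z.
  under eq_bigr do rewrite big_split /= -!mulr_sumr sum_neqE.
  rewrite big_split /= -!mulr_suml sum_neqE.
  have -> : \sum_(i < n) (i == i0)%:R = 1 :> Z.
    by rewrite (bigD1 i0) //= eqxx big1 ?addr0 // => i /negPf->.
  ring.
apply: ler_sum => i _; apply: ler_sum => j _.
rewrite /= !inE negb_or andbT (eq_sym d) (eq_sym d j).
case: ifP => [/andP[/andP[id jd] ij]|_]; last by rewrite addr_ge0 // mulr_ge0.
rewrite id jd mulr1 mul1r natrD lerD // ler_nat.
  by case E: (flag v d i == 7); rewrite // fi0.
by case E: (flag v d j == 7); rewrite // fi0.
Qed.

Lemma triple_sum_nested F : triple_sum F =
  \sum_d \sum_v \sum_i \sum_j (if uniq [:: d; i; j] then F v d i j else 0).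
Proof.
rewrite /triple_sum; apply: eq_bigr => d _.
by rewrite [RHS]exchange_big; apply: eq_bigr => i _; rewrite [RHS]exchange_big.
Qed.

Lemma eq_triple_sum F G : (forall v d i j, F v d i j = G v d i j) ->
  triple_sum F = triple_sum G.
Proof.
move=> FG; apply: eq_bigr => d _; apply: eq_bigr => i _; apply: eq_bigr => j _.
by apply: eq_bigr => v _; rewrite FG.
Qed.

(** The blue weights give the left side. The rest [G] of the kernel is bounded below for each fixed
    (v, d): the Gram part loses its diagonal, the penalty at most 2L(n - 1). *)
Lemma kernel_bound (W L M b : Z) fs : 0 <= L ->
  (forall x f, (f < 8)%N -> gram (fs x) f f <= M) ->
  (L != 0 -> forall v d i j, uniq [:: d; i; j] ->
     ~~ ((flag v d i == 7) && (flag v d j == 7))) ->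
  triple_sum (stat (kernel W L fs)) <= triple_sum (fun _ _ _ _ => b) ->
  W * (n%:R - 1) * (n%:R - 2%:R) * \sum_d \sum_v (c v d)%:R <=
  (n * #|V|)%:R * (n%:R - 1) * (b * (n%:R - 2%:R) + (M + 2%:R * L)).
Proof.
move=> L0 fsM f7.
rewrite (triple_sum_fst (fun _ _ => b)).
set X := \sum_d \sum_v (c v d)%:R.
pose G v d i j := gram (fs (c v d)) (flag v d i) (flag v d j) -
  L * ((flag v d i == 7) + (flag v d j == 7))%:R.
have -> : triple_sum (stat (kernel W L fs)) =
    triple_sum (fun v d i j => W * (c v d)%:R + G v d i j).
  by apply: eq_triple_sum => v d i j; rewrite /stat /kernel /G !mulr_natr addrA.
rewrite triple_sumD (triple_sum_fst (fun v d => W * (c v d)%:R)).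
have -> : \sum_d \sum_v W * (c v d)%:R = W * X.
  by rewrite mulr_sumr; apply: eq_bigr => d _; rewrite mulr_sumr.
have sum_cst x : \sum_(d < n) \sum_(v : V) x = (n * #|V|)%:R * x :> Z.
  under eq_bigr do rewrite sumr_const; rewrite sumr_const card_ord -mulrnA.
  by rewrite mulr_natl mulnC.
rewrite sum_cst.
have G_ge : - ((n * #|V|)%:R * ((n%:R - 1) * (M + 2%:R * L))) <= triple_sum G.
  rewrite triple_sum_nested -mulrN -sum_cst.
  apply: ler_sum => d _; apply: ler_sum => v _.
  have -> : \sum_i \sum_j (if uniq [:: d; i; j] then G v d i j else 0) =
     \sum_i \sum_j (if uniq [:: d; i; j] then
        gram (fs (c v d)) (flag v d i) (flag v d j) else 0) -
     L * \sum_i \sum_j (if uniq [:: d; i; j] then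
        ((flag v d i == 7) + (flag v d j == 7))%:R else 0).
    rewrite mulr_sumr -sumrB; apply: eq_bigr => i _.
    rewrite mulr_sumr -sumrB; apply: eq_bigr => j _.
    by case: ifP => // _; rewrite mulr0 subr0.
  have -> : - ((n%:R - 1) * (M + 2%:R * L)) =
    - ((n%:R - 1) * M) - L * (2%:R * (n%:R - 1)) :> Z by ring.
  apply: lerB; first by apply: gram_sum_ge => f; apply: fsM.
  have [->|Ln0] := eqVneq L 0; first by rewrite !mul0r.
  by apply: ler_wpM2l => //; apply: flag7_sum_le; apply: f7.
move=> le; rewrite -subr_ge0.
rewrite -subr_ge0 in le; rewrite -subr_ge0 in G_ge.
have := addr_ge0 le G_ge; congr (_ <= _); ring.
Qed.

(** * Density bounds for colourings without blue squares or hexagons *)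

Definition no_square : Prop := forall v d i, d != i ->
  ~~ [&& c v d, c v i, c (flip d v) i & c (flip i v) d].

(** The first cycle surrounds the two squares sharing the edge at [v] in direction [d]; the second
    misses [v] and its antipode. *)
Definition no_hexagon : Prop := forall v d i j, uniq [:: d; i; j] ->
  ~~ [&& c v i, c (flip d v) i, c (flip i v) d,
         c v j, c (flip d v) j & c (flip j v) d] /\
  ~~ [&& c (flip i v) d, c (flip j v) d, c (flip d v) i,
         c (flip j v) i, c (flip d v) j & c (flip i v) j].

(** [w] is the common unit of the integer certificate, so that b / W = p / q, and [k] is the error
    in units of [W]. Cancelling w(n - 1) leaves natural numbers. *)
Lemma kernel_bound_nat (w W L M b : Z) fs (p q k : nat) :
  (2 < n)%N -> 0 < w -> 0 <= L -> W = q%:R * w -> b = p%:R * w ->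
  M + 2%:R * L = k%:R * W ->
  (forall x f, (f < 8)%N -> gram (fs x) f f <= M) ->
  (L != 0 -> forall v d i j, uniq [:: d; i; j] ->
     ~~ ((flag v d i == 7) && (flag v d j == 7))) ->
  triple_sum (stat (kernel W L fs)) <= triple_sum (fun (_ : V) (_ _ _ : 'I_n) => b) ->
  (q * (\sum_d \sum_v c v d) * (n - 2) <=
   p * (n * #|V|) * (n - 2) + q * k * (n * #|V|))%N.
Proof.
move=> n2 w0 L0 -> -> MLk fsM f7 /(kernel_bound L0 fsM f7); rewrite MLk.
have -> : \sum_d \sum_v (c v d)%:R = (\sum_d \sum_v c v d)%N%:R :> Z.
  by rewrite natr_sum; apply: eq_bigr => d _; rewrite natr_sum.
move: (\sum_d _)%N (#|V|) => X N le.
have n1 : 0 < w * (n%:R - 1) by rewrite mulr_gt0 // subr_gt0 ltr1n (ltn_trans _ n2).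
rewrite -(ler_nat Z) -(ler_pM2l n1) natrD !natrM natrB 1?ltnW //.
by move: le; congr (_ <= _); rewrite ?natrM; ring.
Qed.

Lemma no_square_bound : (2 < n)%N -> no_square ->
  (2500 * (\sum_d \sum_v c v d) * (n - 2) <=
   1517 * (n * #|V|) * (n - 2) + 2500 * 2 * (n * #|V|))%N.
Proof.
move=> n2 free.
(* The unit is [square_weight] / 2500; the diagonal Gram entries are at most twice the weight. *)
apply: (@kernel_bound_nat 360000%cZ square_weight 0 (2 * square_weight)%cZ
          (1517 * 360000)%cZ square_forms) => //.
- by apply: gram_le_forms; vm_compute.
apply: triple_sum_local => // v d i j u.
apply: (local_checkP square_local_check).
move: u; rewrite /= !inE negb_or andbT => /andP[/andP[di dj] ij].
have := free v d i di; have := free (flip j v) d i di.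
have := free v d j dj; have := free (flip i v) d j dj.
have := free v i j ij; have := free (flip d v) i j ij.
rewrite !(flip_norm d i j) /square_free.
by do 12?[case: (c _ _) => //=].
Qed.

Lemma no_hexagon_bound : (2 < n)%N -> no_hexagon ->
  (2000 * (\sum_d \sum_v c v d) * (n - 2) <=
   751 * (n * #|V|) * (n - 2) + 2000 * 16 * (n * #|V|))%N.
Proof.
move=> n2 free.
(* Two flags with three blue edges on the same edge form a hexagon of the first kind. *)
have f7 v d i j : uniq [:: d; i; j] ->
    ~~ ((flag v d i == 7) && (flag v d j == 7)).
  move=> /(free v)[+ _]; rewrite /flag.
  by case: (c v i); case: (c v j); case: (c _ i); case: (c _ d);
    case: (c _ j); case: (c _ d).
(* The error 16 is 2 for the diagonal plus 2 * 7 for the penalty. *)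
apply: (@kernel_bound_nat 800000%cZ hexagon_weight (7 * hexagon_weight)%cZ
          (2 * hexagon_weight)%cZ (751 * 800000)%cZ hexagon_forms) => //.
- by apply: gram_le_forms; vm_compute.
apply: triple_sum_local => // v d i j u.
apply: (local_checkP hexagon_local_check).
move: (u); rewrite /= !inE negb_or andbT => /andP[/andP[di dj] ij].
have u1 : uniq [:: i; d; j] by rewrite /= !inE negb_or (eq_sym i d) di ij dj.
have u2 : uniq [:: j; d; i] by rewrite /= !inE negb_or (eq_sym j d) (eq_sym j) dj ij di.
(* Sixteen hexagons are collected: one of the first kind for each of the twelve edges, and four of
   the second kind, from [v] and its three neighbours. *)
have := conj (conj (free v d i j u) (free (flip d v) d i j u))
             (conj (free (flip i v) d i j u) (free (flip j v) d i j u)).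
have := conj (free (flip i (flip j v)) d i j u).1
  (conj (conj (free v i d j u1).1 (free (flip d v) i d j u1).1)
        (conj (free (flip j v) i d j u1).1 (free (flip d (flip j v)) i d j u1).1)).
have := conj (conj (free v j d i u2).1 (free (flip d v) j d i u2).1)
        (conj (free (flip i v) j d i u2).1 (free (flip d (flip i v)) j d i u2).1).
rewrite !(flip_norm d i j).
move=> [[h1 h2] [h3 h4]] [h5 [[h6 h7] [h8 h9]]].
move=> [[[h10 h11] [_ h12]] [[h13 h14] [h15 h16]]].
rewrite /hexagon_free !negb_or.
by rewrite h1 h2 h3 h4 h5 h6 h7 h8 h9 h10 h11 h12 h13 h14 h15 h16.
Qed.

End Averaging.

(** * Vertices and edges of the cube *)

Lemma bit_inj n x y : (x < 2 ^ n)%N -> (y < 2 ^ n)%N ->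
  (forall k, (k < n)%N -> bit x k = bit y k) -> x = y.
Proof.
elim: n x y => [|n IH] x y; first by rewrite expn0; case: x; case: y.
rewrite expnS mulnC => xn yn xy.
have e0 : odd x = odd y by have := xy 0%N isT; rewrite /bit expn0 !divn1.
suff : (x %/ 2 = y %/ 2)%N by move=> e; rewrite (divn_eq x 2) (divn_eq y 2) !modn2 e e0.
apply: IH; rewrite ?ltn_divLR // => k kn.
by have := xy k.+1 kn; rewrite /bit expnS !divnMA.
Qed.

Section Cube.

Variable n : nat.
Implicit Types (v w : Q n) (d i j k : 'I_n).

Lemma eq_bits v w : (forall k, bit v k = bit w k) -> v = w.
Proof.
move=> vw; apply/val_inj/(@bit_inj n); rewrite ?ltn_ord // => k kn.
exact: (vw (Ordinal kn)).
Qed.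

(** Reading the bits is injective between two sets of size 2^n, hence surjective. *)
Lemma vertex_of_bits (p : 'I_n -> bool) : exists w, forall k, bit w k = p k.
Proof.
pose f (w : Q n) : {ffun 'I_n -> bool} := [ffun k : 'I_n => bit w k].
have f_inj : injective f.
  by move=> v w /ffunP vw; apply: eq_bits => k; have := vw k; rewrite !ffunE.
have [|g _ gK] := inj_card_bij f_inj.
  by rewrite card_ffun card_bool !card_ord.
by exists (g (finfun p)) => k; have /ffunP/(_ k) := gK (finfun p); rewrite !ffunE.
Qed.

Definition vertex (p : 'I_n -> bool) : Q n := sval (cid (vertex_of_bits p)).

Lemma bit_vertex p k : bit (vertex p) k = p k.
Proof. by rewrite /vertex; case: cid. Qed.

Definition flip d v : Q n := vertex (fun k => bit v k (+) (k == d)).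

Lemma bit_flip d v k : bit (flip d v) k = bit v k (+) (k == d).
Proof. exact: bit_vertex. Qed.

Lemma flipK d : involutive (flip d).
Proof. by move=> v; apply: eq_bits => k; rewrite !bit_flip addbK. Qed.

Lemma flipC d i v : flip d (flip i v) = flip i (flip d v).
Proof. by apply: eq_bits => k; rewrite !bit_flip addbAC. Qed.

Lemma flip_injl v : injective (flip^~ v).
Proof.
move=> d i /(congr1 (fun w : Q n => bit w d)); rewrite !bit_flip eqxx.
by case: eqP => // _; case: (bit v d).
Qed.

Lemma flip_neq d v : flip d v != v.
Proof.
apply/eqP => /(congr1 (fun w : Q n => bit w d)); rewrite bit_flip eqxx.
by case: (bit v d).
Qed.

Lemma adj_flipP v w : reflect (exists d, w = flip d v) (adj v w).
Proof.
apply: (iffP cards1P) => [[d vw]|[d ->]]; exists d.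
  apply: eq_bits => k; rewrite bit_flip; have /finset.setP/(_ k) := vw.
  by rewrite !inE => <-; case: (bit v k); case: (bit w k).
apply/finset.setP => k; rewrite !inE bit_flip.
by case: (bit v k); case: (k == d).
Qed.

Lemma adj_flip d v : adj v (flip d v).
Proof. by apply/adj_flipP; exists d. Qed.

End Cube.

Lemma edges_adj (G : sgraph) (x y : G) : ([set x; y]%SET \in edges G) = adj x y.
Proof.
apply/idP/idP => [|/mem_edges//].
rewrite inE => /existsP[a /existsP[b /andP[ab /eqP/finset.setP e]]].
have nab : a != b by apply: contraTneq ab => ->; rewrite adj_irr.
have := e a; have := e b; have := e x; have := e y; rewrite !inE !eqxx /= !orbT.
rewrite orbC => /esym/orP[]/eqP-> /esym/orP[]/eqP->;
  rewrite ?eqxx ?(negPf nab) ?[b == a]eq_sym ?(negPf nab) //=.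
by move=> _ _; rewrite adj_sym.
Qed.

Section EdgeCount.

Variable n : nat.
Implicit Types (E : {set {set Q n}}).

Definition has_edge E (v : Q n) (d : 'I_n) : bool := [set v; flip d v]%SET \in E.

Lemma has_edge_flip E d v : has_edge E (flip d v) d = has_edge E v d.
Proof. by rewrite /has_edge flipK finset.setUC. Qed.

(** Each edge is read exactly twice, from its two ends and with the same direction. *)
Lemma sum_has_edge E : E \subset edges (Q n) ->
  (\sum_d \sum_v has_edge E v d = 2 * #|E|)%N.
Proof.
move=> sE.
rewrite pair_big /=.
transitivity (\sum_(p : 'I_n * Q n) \sum_(e in E) ([set p.2; flip p.1 p.2]%SET == e))%N.
  apply: eq_bigr => -[d v] _ /=; rewrite /has_edge.
  case: (boolP (_ \in E)) => vE.
    by rewrite (bigD1 _ vE) /= eqxx big1 ?addn0 // => e /andP[_];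
      rewrite eq_sym => /negPf->.
  by rewrite big1 // => e eE; apply/eqP; rewrite eqb0; apply: contraNneq vE => ->.
rewrite exchange_big /= mulnC -sum_nat_const; apply: eq_bigr => e eE.
have := fintype.subsetP sE e eE; rewrite inE.
move=> /existsP[x /existsP[y /andP[/adj_flipP[d ->] /eqP->]]].
transitivity #|[set (d, x); (d, flip d x)]%SET|; last first.
  by rewrite cards2 xpair_eqE eqxx /= eq_sym flip_neq.
rewrite -sum1_card [RHS]big_mkcond /=; apply: eq_bigr => -[i v] _ /=.
suff -> : ((i, v) \in [set (d, x); (d, flip d x)]%SET) =
    ([set v; flip i v]%SET == [set x; flip d x]%SET) by case: (_ == _).
rewrite !inE /= !xpair_eqE -andb_orr.
apply/andP/eqP => [[/eqP-> /orP[]/eqP->//]|/finset.setP e2].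
  by rewrite flipK finset.setUC.
have := e2 v; rewrite !inE eqxx /= => /esym vx; split=> //.
have := e2 (flip i v); rewrite !inE eqxx orbT => /esym.
case/orP: vx => /eqP ->.
  by rewrite (negPf (flip_neq _ _)) /= => /eqP/flip_injl->.
rewrite orbC (negPf (flip_neq _ _)) /= => /eqP e3; apply/eqP.
by apply: (@flip_injl _ (flip d x)); rewrite e3 flipK.
Qed.

Lemma card_edges_cube : (2 * #|edges (Q n)| = n * 2 ^ n)%N.
Proof.
rewrite -sum_has_edge //.
under eq_bigr => d _ do under eq_bigr => v _ do rewrite /has_edge edges_adj adj_flip.
by under eq_bigr => d _ do rewrite sum1_card card_ord; rewrite sum_nat_const card_ord.
Qed.

End EdgeCount.

(** * Free families as excluded embeddings *)

(** Depends on an edge set alone, which makes it the common form of freeness for subgraphs and for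
    colourings. *)
Definition embeds (H : sgraph) n (E : {set {set Q n}}) : Prop :=
  exists2 g : H -> Q n, injective g & forall x y, adj x y -> [set g x; g y]%SET \in E.

Lemma set2_adj (G : sgraph) (x y a b : G) :
  adj x y -> [set x; y]%SET = [set a; b]%SET -> adj a b.
Proof. by rewrite -!edges_adj => + <-. Qed.

(** Every vertex of [H] lies on an edge, so an embedding into [S.2] has its vertices in [S.1]. The
    subgraph sought is its image with the image edges only, as copies need not be induced. *)
Lemma gfree_embeds (H : sgraph) n (S : presub (Q n)) : is_subgraph S ->
  (forall x : H, exists y, adj x y) ->
  gfree (eq H) (subgraph S) <-> ~ embeds H S.2.
Proof.
move=> /andP[_ /fintype.subsetP S12] nisol.
split=> [free [g g_inj gS]|noemb [S' [/andP[S'e _] [_ [<- [f [f' fK f'K] fadj]]]]]].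
  apply: free.
  have gS1 x : g x \in S.1.
    have [y /gS xy] := nisol x; apply/S12/finset.bigcupP.
    by exists [set g x; g y]%SET => //; rewrite !inE eqxx.
  pose g' x : subgraph S := exist (fun z => z \in S.1) (g x) (gS1 x).
  have g'_inj : injective g' by move=> x y /(congr1 val)/g_inj.
  have g'_adj x y : adj x y -> adj (g' x) (g' y).
    move=> xy; rewrite /adj /= /sub_adj /= gS // andbT (inj_eq g_inj).
    by apply: contraTneq xy => ->; rewrite adj_irr.
  pose S' : presub (subgraph S) := ((g' @: finset.setT)%SET,
    [set e | [exists x, exists y, adj x y && (e == [set g' x; g' y]%SET)]]%SET).
  have S'e e : e \in S'.2 -> exists x y, adj x y /\ e = [set g' x; g' y]%SET.
    by rewrite inE => /existsP[x /existsP[y /andP[xy /eqP]]]; exists x, y.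
  exists S'; split.
    apply/andP; split.
      by apply/fintype.subsetP => e /S'e[x [y [xy ->]]]; rewrite edges_adj g'_adj.
    apply/fintype.subsetP => z /finset.bigcupP[e /S'e[x [y [xy ->]]]].
    by rewrite !inE => /orP[]/eqP->; apply: imset_f.
  exists H; split=> //.
  have hS x : g' x \in S'.1 by apply: imset_f.
  pose h x : subgraph S' := exist (fun z => z \in S'.1) (g' x) (hS x).
  have h_inj : injective h by move=> x y /(congr1 val)/g'_inj.
  have h_adj x y : adj (h x) (h y) = adj x y.
    rewrite -[LHS]/(sub_adj (h x) (h y)) /sub_adj /= (inj_eq g'_inj).
    apply/andP/idP => [[nxy /S'e[a [b [ab]]]]|xy].
      rewrite -!finset.imset_set1 -!finset.imsetU => /(finset.imset_inj g'_inj)/esym.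
      exact: set2_adj.
    split; first by apply: contraTneq xy => ->; rewrite adj_irr.
    by rewrite inE; apply/existsP; exists x; apply/existsP; exists y; rewrite xy /=.
  have [|h' hK h'K] := inj_card_bij h_inj.
    rewrite card_sig /= (eq_card (B := mem (g' @: finset.setT)%SET)) //.
    by rewrite card_imset // cardsT.
  by exists h'; [exists h | move=> x y; rewrite -h_adj !h'K].
apply: noemb; exists (fun x => val (val (f' x))).
  by move=> x y /val_inj/val_inj/(can_inj f'K).
move=> x y; rewrite -{1}(f'K x) -{1}(f'K y) fadj.
move=> /andP[_ /(fintype.subsetP S'e)]; rewrite edges_adj.
by move=> /andP[].
Qed.

Definition blue_edges n (k : {ffun edge (Q n) -> bool}) : {set {set Q n}} :=
  [set val e | e in [set e | k e == blue]%SET]%SET.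

Lemma blue_edges_sub n (k : {ffun edge (Q n) -> bool}) : blue_edges k \subset edges (Q n).
Proof. by apply/fintype.subsetP => e /finset.imsetP[[e' he] _ ->]. Qed.

Lemma card_blue_edges n (k : {ffun edge (Q n) -> bool}) :
  #|blue_edges k| = #|[set e | k e == blue]%SET|.
Proof. by apply: card_imset; exact: val_inj. Qed.

Lemma mem_blue_edges n (k : {ffun edge (Q n) -> bool}) (x y : Q n) (h : adj x y) :
  ([set x; y]%SET \in blue_edges k) = (k (mkedge h) == blue).
Proof.
apply/finset.imsetP/idP => [[e]|kb]; last by exists (mkedge h); rewrite ?inE.
by rewrite inE => eb xy; rewrite (_ : mkedge h = e) //; apply: val_inj.
Qed.

Lemma blue_edges_adj n (k : {ffun edge (Q n) -> bool}) (x y : Q n) :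
  [set x; y]%SET \in blue_edges k -> adj x y.
Proof. by move/(fintype.subsetP (blue_edges_sub k)); rewrite edges_adj. Qed.

(* An isomorphism is only required to preserve edges; it reflects them because
   both cubes then have the same number of edges. *)
Lemma cube_bij_reflects m (f : Q m -> Q m) : bijective f ->
  (forall x y, adj x y -> adj (f x) (f y)) ->
  forall x y, adj (f x) (f y) -> adj x y.
Proof.
move=> [f' fK f'K] fadj x y; rewrite -!edges_adj.
have f_inj := can_inj fK.
have E : [set f @: (e : {set Q m}) | e in edges (Q m)]%SET = edges (Q m).
  apply/eqP; rewrite eqEcard card_imset ?leqnn ?andbT; last exact: finset.imset_inj.
  apply/fintype.subsetP => _ /finset.imsetP[e + ->].
  rewrite inE => /existsP[a /existsP[b /andP[ab /eqP->]]].
  by rewrite finset.imsetU !finset.imset_set1 edges_adj fadj.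
rewrite -{1}E => /finset.imsetP[e ee].
by rewrite -!finset.imset_set1 -finset.imsetU => /(finset.imset_inj f_inj) ->.
Qed.

(** Counting vertices gives equal dimensions. The embedding is then composed with the inverse
    isomorphism, which preserves edges by [cube_bij_reflects]. *)
Lemma subcube_iso K M H : subcube K H -> ecube_iso K M -> subcube M H.
Proof.
case: K M => [a k] [b m] [g g_inj gadj] [f f_bij fadj] /=.
have eab : a = b.
  have := bij_eq_card f_bij; rewrite /= !card_ord => /eqP.
  by rewrite eqn_exp2l // => /eqP.
subst b => /=.
have f_hom x y : adj x y -> adj (f x) (f y) by move=> h; have [] := fadj x y h.
have [f' fK f'K] := f_bij.
exists (g \o f'); first exact: inj_comp g_inj (can_inj f'K).
move=> x y h /=.
have h1 : adj (f' x) (f' y) by apply: (cube_bij_reflects f_bij f_hom); rewrite !f'K.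
have [h2 h2b] := gadj _ _ h1; exists h2 => xyb; apply: h2b.
have [h3 ->] := fadj _ _ h1; rewrite -xyb /=; congr (m _); apply: val_inj.
by rewrite /= !f'K.
Qed.

Lemma cfreeE (F : set ecube) H : cfree F H <-> ~ exists2 M, F M & subcube M H.
Proof.
split=> [free [M FM MH]|free [K [KH [M [FM KM]]]]].
  apply: free; exists M; split=> //; exists M; split=> //.
  by exists id; [exists id | move=> x y h; exists h].
by apply: free; exists M => //; apply: subcube_iso KM.
Qed.

Lemma cfree_square n (k : {ffun edge (Q n) -> bool}) :
  cfree [set B]%classic (ECube k) <-> ~ embeds (Q 2) (blue_edges k).
Proof.
rewrite cfreeE; split=> no.
  move=> [g g_inj gb]; apply: no; exists B => //; exists g => // x y h.
  have h' := blue_edges_adj (gb _ _ h); exists h' => _.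
  by apply/eqP; rewrite -mem_blue_edges gb.
move=> [_ -> [g g_inj gb]]; apply: no; exists g => // x y h.
have [h' kb] := gb x y h; rewrite mem_blue_edges; apply/eqP/kb.
by rewrite ffunE.
Qed.

(** * Squares and hexagons *)

Section Span.

Variables (m n : nat) (e : 'I_m -> 'I_n) (v : Q n).

(** The affine map over the field with two elements that sends 0 to [v] and direction [t] to
    direction [e t]. *)
Definition span (u : Q m) : Q n :=
  vertex (fun k => bit v k (+) \big[addb/false]_(t < m) ((k == e t) && bit u t)).

Lemma span_flip t u : span (flip t u) = flip (e t) (span u).
Proof.
apply: eq_bits => k; rewrite bit_flip !bit_vertex -addbA; congr (_ (+) _).
under eq_bigr => s _ do rewrite bit_flip andb_addr.
rewrite big_split /=; congr (_ (+) _).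
by rewrite (bigD1 t) //= eqxx andbT big1 ?addbF // => s /negPf->; rewrite andbF.
Qed.

Lemma span_inj : injective e -> injective span.
Proof.
move=> e_inj u w uw; apply: eq_bits => t.
have bit_span x : bit (span x) (e t) = bit v (e t) (+) bit x t.
  rewrite bit_vertex (bigD1 t) //= eqxx /= big1 ?addbF // => s st.
  by rewrite (inj_eq e_inj) eq_sym (negPf st).
by have := bit_span u; rewrite uw bit_span => /addbI.
Qed.

End Span.

Lemma embeds_square n (E : {set {set Q n}}) :
  ~ embeds (Q 2) E -> no_square (@flip n) (has_edge E).
Proof.
move=> noemb v d i di; apply/negP => /and4P[vd vi dvi ivd]; apply: noemb.
pose e (t : 'I_2) := if t == ord0 then d else i.
have e_inj : injective e.
  case=> [[|[|s]] ?] [[|[|t]] ?] //; rewrite /e /= => ei; try exact: val_inj.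
    by rewrite ei eqxx in di.
  by rewrite ei eqxx in di.
have spanE u : span e v u = iter (bit u 0) (flip d) (iter (bit u 1) (flip i) v).
  apply: eq_bits => k; rewrite bit_vertex !big_ord_recl big_ord0 /e /= /bump /= addn0.
  by case: (bit u 0); case: (bit u 1);
    rewrite /= ?bit_flip ?andbT ?andbF ?addbF //= addbAC addbA.
exists (span e v); first exact: span_inj.
move=> x y /adj_flipP[t ->]; rewrite span_flip -/(has_edge E _ _) spanE.
case: t => [[|[|t]] ht] //; rewrite /e /=.
  by case: (bit x 0); case: (bit x 1); rewrite /= ?has_edge_flip.
by case: (bit x 0); case: (bit x 1); rewrite /= 1?flipC ?has_edge_flip.
Qed.

Definition hexagon n (E : {set {set Q n}}) (x0 x1 x2 x3 x4 x5 : Q n) : bool :=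
  [&& uniq [:: x0; x1; x2; x3; x4; x5],
      [set x0; x1]%SET \in E, [set x1; x2]%SET \in E, [set x2; x3]%SET \in E,
      [set x3; x4]%SET \in E, [set x4; x5]%SET \in E & [set x5; x0]%SET \in E].

Lemma embeds_hexagon n (E : {set {set Q n}}) :
  embeds C6 E <-> exists x0 x1 x2 x3 x4 x5, hexagon E x0 x1 x2 x3 x4 x5.
Proof.
split=> [[g g_inj gE]|[x0 [x1 [x2 [x3 [x4 [x5 /and5P[u h0 h1 h2 /and3P[h3 h4 h5]]]]]]]]].
  pose o k (h : (k < 6)%N) : 'I_6 := Ordinal h.
  exists (g (o 0%N isT)), (g (o 1%N isT)), (g (o 2%N isT)), (g (o 3%N isT)),
    (g (o 4%N isT)), (g (o 5%N isT)).
  apply/andP; split; last by rewrite !gE.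
  by rewrite -[X in uniq X]/(map g [:: o 0%N isT; o 1%N isT; o 2%N isT;
    o 3%N isT; o 4%N isT; o 5%N isT]) map_inj_uniq.
pose s := [:: x0; x1; x2; x3; x4; x5].
have sE (i : 'I_6) : [set nth x0 s i; nth x0 s (ordS i)]%SET \in E.
  by case: i => [[|[|[|[|[|[|i]]]]]] hi].
exists (fun i : C6 => nth x0 s i).
  by move=> i j /eqP; rewrite nth_uniq // => /eqP/val_inj.
move=> i j /orP[]/eqP->; first exact: sE.
by rewrite finset.setUC; apply: sE.
Qed.

(** Corners are indexed by boolean triples, so that distinctness of vertices becomes a computation
    through [corner_inj]. *)
Definition corner n (v : Q n) (d i j : 'I_n) (t : bool * bool * bool) : Q n :=
  iter t.1.1 (flip d) (iter t.1.2 (flip i) (iter t.2 (flip j) v)).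

Lemma corner_inj n (v : Q n) (d i j : 'I_n) : uniq [:: d; i; j] ->
  injective (corner v d i j).
Proof.
rewrite /= !inE negb_or andbT => /andP[/andP[/negPf di /negPf dj] /negPf ij].
pose r (w : Q n) := (bit v d (+) bit w d, bit v i (+) bit w i, bit v j (+) bit w j).
apply: (can_inj (g := r)) => -[[b0 b1] b2]; rewrite /r /corner /=.
have bit_iter (b : bool) k w (l : 'I_n) :
    bit (iter b (flip k) w) l = bit w l (+) (b && (l == k)).
  by case: b; rewrite /= ?bit_flip ?addbF.
rewrite !bit_iter !eqxx ![_ == d]eq_sym [j == i]eq_sym di dj ij !andbF !andbT !addbF.
by rewrite !addbA !addbb.
Qed.

Lemma embeds_no_hexagon n (E : {set {set Q n}}) :
  ~ embeds C6 E -> no_hexagon (@flip n) (has_edge E).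
Proof.
move=> noemb v d i j u; rewrite /has_edge.
split; apply/negP => /and5P[h0 h1 h2 h3 /andP[h4 h5]]; apply: noemb; apply/embeds_hexagon.
  exists v, (flip i v), (flip d (flip i v)), (flip d v), (flip d (flip j v)), (flip j v).
  apply/andP; split.
    rewrite -[X in uniq X]/(map (corner v d i j) [:: (false, false, false);
      (false, true, false); (true, true, false); (true, false, false);
      (true, false, true); (false, false, true)]).
    by rewrite (map_inj_uniq (corner_inj u)).
  rewrite h0 h2 (finset.setUC [set flip d (flip i v)]%SET) (flipC d i) h1.
  by rewrite (flipC d j) h4 (finset.setUC _ [set flip j v]%SET) -(flipC d j) h5
    finset.setUC h3.
exists (flip d v), (flip d (flip i v)), (flip i v),
  (flip i (flip j v)), (flip j v), (flip d (flip j v)).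
apply/andP; split.
  rewrite -[X in uniq X]/(map (corner v d i j) [:: (true, false, false);
    (true, true, false); (false, true, false); (false, true, true);
    (false, false, true); (true, false, true)]).
  by rewrite (map_inj_uniq (corner_inj u)).
rewrite {1}(flipC d i) h2 (finset.setUC _ [set flip i v]%SET) h0.
rewrite {1}(flipC i j) h5 (finset.setUC _ [set flip j v]%SET) h3 h1.
by rewrite (flipC d j) finset.setUC h4.
Qed.

(** * Blue hexagons as copies of [B1] and [B2] *)

Lemma blue_of_pairs m (s : seq (nat * nat)) (x y : Q m) (h : adj x y) :
  reflect (exists2 p, p \in s & (val x, val y) = p \/ (val y, val x) = p)
    (Defs.col (ecube_of_blue m s) (mkedge h) == blue).
Proof.
rewrite ffunE /=.
have -> a b : ((if b then blue else red) == a) = (b == a) by case: b.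
rewrite eqb_id; apply: (iffP hasP) => -[p ps pxy]; exists p => //.
  move: pxy => /eqP/finset.setP pxy.
  have := pxy x; have := pxy y; rewrite !inE !eqxx orbT /= => /esym yp /esym xp.
  have nxy : (x : nat) != y.
    by apply: contraTneq h => /val_inj->; rewrite adj_irr.
  case: p yp xp {ps pxy} => a b /=.
  by case/orP=> /eqP yb; case/orP=> /eqP xa;
    rewrite ?xa ?yb ?eqxx // in nxy *; [right|left].
by apply/eqP/finset.setP => z; case: pxy => <-; rewrite !inE //= orbC.
Qed.

(** [subcube] asks nothing of the colours of images of red edges, so only the listed pairs
    matter. *)
Lemma subcube_span n (e : 'I_3 -> 'I_n) (v : Q n) (s : seq (nat * nat)) k :
  injective e ->
  (forall x y : Q 3, (val x, val y) \in s ->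
     [set span e v x; span e v y]%SET \in blue_edges k) ->
  subcube (ecube_of_blue 3 s) (ECube k).
Proof.
move=> e_inj sk; exists (span e v); first exact: span_inj.
move=> x y h; have h' : adj (span e v x) (span e v y).
  by move/adj_flipP: h => [t ->]; rewrite span_flip adj_flip.
exists h' => /eqP/blue_of_pairs[p ps xy]; apply/eqP; rewrite -mem_blue_edges.
case: xy ps => <- /sk //.
by rewrite finset.setUC.
Qed.

Definition frame n (a b c : 'I_n) (t : 'I_3) : 'I_n := nth a [:: a; b; c] t.

Lemma frame_inj n (a b c : 'I_n) : uniq [:: a; b; c] -> injective (frame a b c).
Proof. by move=> u s t /eqP; rewrite nth_uniq // => /eqP/val_inj. Qed.

Lemma span_frame n (a b c : 'I_n) v (u : Q 3) :
  span (frame a b c) v u = corner v a b c (bit u 0, bit u 1, bit u 2).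
Proof.
apply: eq_bits => k; rewrite bit_vertex !big_ord_recl big_ord0 /frame /= /corner /=.
rewrite /bump /= !addn0.
case: (bit u 0); case: (bit u 1); case: (bit u 2);
  rewrite /= ?bit_flip ?andbT ?andbF ?addbF //=;
  by case: (bit v k); case: (k == a); case: (k == b); case: (k == c).
Qed.

(** With [a], [b], [c] as binary digits 0, 1, 2 above [v], the cycle reads 0, 1, 3, 2, 6, 4. *)
Lemma subcube_B1 n (v : Q n) (a b c : 'I_n) k : uniq [:: a; b; c] ->
  hexagon (blue_edges k) v (flip a v) (flip a (flip b v)) (flip b v)
    (flip b (flip c v)) (flip c v) ->
  subcube B1 (ECube k).
Proof.
move=> u /and5P[_ h0 h1 h2 /and3P[h3 h4 h5]].
apply: (subcube_span (v := v) (frame_inj u)) => x y; rewrite !inE !xpair_eqE !span_frame.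
by do 5?[case/orP]; move=> /andP[/eqP-> /eqP->].
Qed.

(** In the same digits the cycle reads 5, 1, 3, 2, 6, 4; the base [v] is not on it. *)
Lemma subcube_B2 n (v : Q n) (a b c : 'I_n) k : uniq [:: a; b; c] ->
  hexagon (blue_edges k) (flip a (flip c v)) (flip a v) (flip a (flip b v)) (flip b v)
    (flip b (flip c v)) (flip c v) ->
  subcube B2 (ECube k).
Proof.
move=> u /and5P[_ h0 h1 h2 /and3P[h3 h4 h5]].
apply: (subcube_span (v := v) (frame_inj u)) => x y; rewrite !inE !xpair_eqE !span_frame.
by do 5?[case/orP]; move=> /andP[/eqP-> /eqP->].
Qed.

(** Every value occurs an even number of times among the four, so they pair up. *)
Lemma matching4 (T : eqType) (a b c d : T) :
  (forall k, ((k == a) (+) (k == b) (+) (k == c) (+) (k == d)) = false) ->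
  [\/ a = b /\ c = d, a = c /\ b = d | a = d /\ b = c].
Proof.
move=> par; have [ab|nab] := eqVneq a b.
  subst b; have := par c; rewrite addbb eqxx; case: (eqVneq c d) => // -> _.
  by constructor 1.
have [ac|nac] := eqVneq a c.
  subst c; have := par b; rewrite eq_sym (negPf nab) eqxx.
  by case: (eqVneq b d) => // -> _; constructor 2.
have := par a; rewrite eqxx (negPf nab) (negPf nac); case: (eqVneq a d) => // ad _.
subst d; have := par b; rewrite eqxx eq_sym (negPf nab).
by case: (eqVneq b c) => // -> _; constructor 3.
Qed.

Lemma hexagon_rot n (E : {set {set Q n}}) x0 x1 x2 x3 x4 x5 :
  hexagon E x0 x1 x2 x3 x4 x5 -> hexagon E x1 x2 x3 x4 x5 x0.
Proof.
move=> /and5P[u h0 h1 h2 /and3P[h3 h4 h5]]; apply/and5P; split=> //; last by apply/and3P.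
by rewrite -(rot_uniq 1) in u.
Qed.

(* Each direction occurs an even number of times along a hexagon; the possible
   coincidences of directions leave the words abcabc and, up to rotation,
   abacbc. *)
Lemma hexagon_subcube n (k : {ffun edge (Q n) -> bool}) x0 x1 x2 x3 x4 x5 :
  hexagon (blue_edges k) x0 x1 x2 x3 x4 x5 ->
  subcube B1 (ECube k) \/ subcube B2 (ECube k).
Proof.
move=> hx; case/and5P: (hx) => u h0 h1 h2 /and3P[h3 h4 h5].
have /adj_flipP[d0 e1] := blue_edges_adj h0.
have /adj_flipP[d1 e2] := blue_edges_adj h1.
have /adj_flipP[d2 e3] := blue_edges_adj h2.
have /adj_flipP[d3 e4] := blue_edges_adj h3.
have /adj_flipP[d4 e5] := blue_edges_adj h4.
have /adj_flipP[d5 e6] := blue_edges_adj h5.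
(* Consecutive directions differ, as otherwise the walk would return to [x]. *)
have turn (x y z : Q n) d i : x != z -> y = flip d x -> z = flip i y -> d != i.
  by move=> xz -> zi; apply: contraNneq xz => di; rewrite zi di flipK.
have [[n02 n13] [n24 n35] [n40 n51]] :
    [/\ x0 != x2 /\ x1 != x3, x2 != x4 /\ x3 != x5 & x4 != x0 /\ x5 != x1].
  move: u; rewrite /= !inE !negb_or ![_ == x0]eq_sym ![_ == x1]eq_sym.
  move=> /and5P[/and5P[_ -> _ -> _] /and4P[_ -> _ ->] /and3P[_ -> _] /andP[_ ->] _].
  by split.
have n01 := turn _ _ _ _ _ n02 e1 e2; have n12 := turn _ _ _ _ _ n13 e2 e3.
have n23 := turn _ _ _ _ _ n24 e3 e4; have n34 := turn _ _ _ _ _ n35 e4 e5.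
have n45 := turn _ _ _ _ _ n40 e5 e6; have n50 := turn _ _ _ _ _ n51 e6 e1.
(* A closed walk flips every bit an even number of times. *)
have par t : (t == d0) (+) (t == d1) (+) (t == d2) (+)
    (t == d3) (+) (t == d4) (+) (t == d5) = false.
  have : bit x0 t = bit x0 t by [].
  rewrite {1}e6 e5 e4 e3 e2 e1 !bit_flip => /(congr1 (addb (bit x0 t))).
  by rewrite addbb !addbA addbb addFb.
have [m02|n02'] := eqVneq d0 d2.
  case: (@matching4 _ d1 d3 d4 d5) => [t|[_ e45]|[e14 e35]|[_ e34]].
  - by have := par t; rewrite m02; case: (t == d1); case: (t == d2);
      case: (t == d3); case: (t == d4); case: (t == d5).
  - by rewrite e45 eqxx in n45.
  - left; apply: (@subcube_B1 _ x0 d0 d1 d3).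
      by rewrite /= !inE negb_or n01 m02 n23 /= e14 eq_sym n34.
    have q1 := e1.
    have q2 : x2 = flip d0 (flip d1 x0) by rewrite e2 e1 flipC.
    have q3 : x3 = flip d1 x0 by rewrite e3 q2 -m02 flipK.
    have q4 : x4 = flip d1 (flip d3 x0) by rewrite e4 q3 flipC.
    have q5 : x5 = flip d3 x0 by rewrite e5 q4 -e14 flipK.
    by move: hx; rewrite q5 q4 q3 q2 q1.
  - by rewrite e34 eqxx in n34.
have [m03|n03] := eqVneq d0 d3.
  case: (@matching4 _ d1 d2 d4 d5) => [t|[e12 _]|[e14 e25]|[e15 e24]].
  - by have := par t; rewrite m03; case: (t == d1); case: (t == d2);
      case: (t == d3); case: (t == d4); case: (t == d5).
  - by rewrite e12 eqxx in n12.
  (* The word is abcabc; [v] is one of the two corners off the cycle. *)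
  - right; pose v := flip d2 (flip d0 x0); apply: (@subcube_B2 _ v d2 d1 d0).
      by rewrite /= !inE negb_or [d2 == d1]eq_sym
        [d2 == d0]eq_sym [d1 == d0]eq_sym n12 n02' n01.
    have q0 : x0 = flip d2 (flip d0 v) by rewrite /v (flipC d0) !flipK.
    have q1 : x1 = flip d2 v by rewrite e1 q0 flipC flipK.
    have q2 : x2 = flip d2 (flip d1 v) by rewrite e2 q1 flipC.
    have q3 : x3 = flip d1 v by rewrite e3 q2 flipK.
    have q4 : x4 = flip d1 (flip d0 v) by rewrite e4 q3 -m03 flipC.
    have q5 : x5 = flip d0 v by rewrite e5 q4 -e14 flipK.
    by move: hx; rewrite q5 q4 q3 q2 q1 q0.
  (* The word abcacb, read from [x5], is babcac. *)
  - left; apply: (@subcube_B1 _ x5 d1 d0 d2).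
      by rewrite /= !inE negb_or [d1 == d0]eq_sym n12 n02' n01.
    have q0 : x0 = flip d1 x5 by rewrite e15 -e6.
    have q1 : x1 = flip d1 (flip d0 x5) by rewrite e1 q0 flipC.
    have q2 : x2 = flip d0 x5 by rewrite e2 q1 flipK.
    have q3 : x3 = flip d0 (flip d2 x5) by rewrite e3 q2 flipC.
    have q4 : x4 = flip d2 x5 by rewrite e4 q3 -m03 flipK.
    by move: hx; do 5!move/hexagon_rot; rewrite q4 q3 q2 q1 q0.
have [m04|n04] := eqVneq d0 d4.
  case: (@matching4 _ d1 d2 d3 d5) => [t|[e12 _]|[e13 e25]|[_ e23]].
  - by have := par t; rewrite m04; case: (t == d1); case: (t == d2);
      case: (t == d3); case: (t == d4); case: (t == d5).
  - by rewrite e12 eqxx in n12.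
  (* The word abcbac, read from [x1], is bcbaca. *)
  - left; apply: (@subcube_B1 _ x1 d1 d2 d0).
      by rewrite /= !inE negb_or [d1 == d0]eq_sym [d2 == d0]eq_sym n12 n02' n01.
    have q2 := e2.
    have q3 : x3 = flip d1 (flip d2 x1) by rewrite e3 q2 flipC.
    have q4 : x4 = flip d2 x1 by rewrite e4 q3 -e13 flipK.
    have q5 : x5 = flip d2 (flip d0 x1) by rewrite e5 q4 -m04 flipC.
    have q0 : x0 = flip d0 x1 by rewrite e6 q5 -e25 flipK.
    by move: hx => /hexagon_rot; rewrite q0 q5 q4 q3 q2.
  - by rewrite e23 eqxx in n23.
(* Otherwise [d0] would occur only once, against parity. *)
have := par d0; rewrite eqxx (negPf n01) (negPf n02') (negPf n03) (negPf n04).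
by rewrite eq_sym (negPf n50).
Qed.

Lemma hexagon_of_pairs n (k : {ffun edge (Q n) -> bool}) (y0 y1 y2 y3 y4 y5 : Q 3) :
  uniq [:: y0; y1; y2; y3; y4; y5] ->
  [&& adj y0 y1, adj y1 y2, adj y2 y3, adj y3 y4, adj y4 y5 & adj y5 y0] ->
  subcube (ecube_of_blue 3 [:: (val y0, val y1); (val y1, val y2); (val y2, val y3);
     (val y3, val y4); (val y4, val y5); (val y5, val y0)]) (ECube k) ->
  embeds C6 (blue_edges k).
Proof.
move=> u /and5P[a0 a1 a2 a3 /andP[a4 a5]] [g g_inj gb]; apply/embeds_hexagon.
exists (g y0), (g y1), (g y2), (g y3), (g y4), (g y5); apply/andP; split.
  by rewrite -[X in uniq X]/(map g [:: y0; y1; y2; y3; y4; y5]) map_inj_uniq.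
have step (x y : Q 3) (h : adj x y) :
    (val x, val y) \in [:: (val y0, val y1); (val y1, val y2);
    (val y2, val y3); (val y3, val y4); (val y4, val y5); (val y5, val y0)] ->
    [set g x; g y]%SET \in blue_edges k.
  move=> xy; have [h' kb] := gb x y h; rewrite mem_blue_edges; apply/eqP/kb/eqP.
  by apply/blue_of_pairs; exists (val x, val y) => //; left.
by rewrite !step // !inE eqxx ?orbT.
Qed.

Lemma adj3_bits (x y : Q 3) :
  ((bit x 0 != bit y 0) + (bit x 1 != bit y 1) + (bit x 2 != bit y 2))%N = 1%N -> adj x y.
Proof.
move=> xy; apply/eqP; rewrite -sum1_card big_mkcond /= !big_ord_recl big_ord0 /= !inE.
by rewrite -{}[RHS]xy addn0 addnA.
Qed.

Lemma cfree_hexagon n (k : {ffun edge (Q n) -> bool}) :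
  cfree [set B1; B2]%classic (ECube k) <-> ~ embeds C6 (blue_edges k).
Proof.
rewrite cfreeE; split=> no.
  move=> /embeds_hexagon[x0 [x1 [x2 [x3 [x4 [x5 /hexagon_subcube[]]]]]]] s; apply: no.
    by exists B1 => //; left.
  by exists B2 => //; right.
pose o i (h : (i < 2 ^ 3)%N) : Q 3 := Ordinal h.
by move=> [_ [] -> s]; apply: no;
  [apply: (@hexagon_of_pairs _ _ (o 0%N isT) (o 1%N isT) (o 3%N isT)
     (o 2%N isT) (o 6%N isT) (o 4%N isT))
  |apply: (@hexagon_of_pairs _ _ (o 5%N isT) (o 1%N isT) (o 3%N isT)
     (o 2%N isT) (o 6%N isT) (o 4%N isT))] => //;
  rewrite !adj3_bits.
Qed.

(** * Densities *)

(** Subgraphs and colourings correspond through their edge sets. The vertex set of a subgraph does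
    not affect its density, so the full one is taken for a colouring. *)
Lemma ex_density_eq (R : realType) (H : sgraph) (F : set ecube) n :
  (forall x : H, exists y, adj x y) ->
  (forall k, cfree F (ECube k) <-> ~ embeds H (@blue_edges n k)) ->
  ex_density R (eq H) n = ex_cdensity R F n.
Proof.
move=> nisol FH; apply/le_anti/andP; split.
  apply: bigmax_le => [|S /andP[sS /asboolP]]; first exact: bigmax_ge_id.
  rewrite gfree_embeds // => noemb.
  pose k : {ffun edge (Q n) -> bool} := [ffun e => val e \in S.2].
  have kS : blue_edges k = S.2.
    apply/finset.setP => e; apply/finset.imsetP/idP => [[e' + ->]|eS].
      by rewrite inE ffunE => /eqP.
    have ee : e \in edges (Q n) by case/andP: sS => /fintype.subsetP + _; apply.
    by exists (exist (fun e => e \in edges (Q n)) e ee); rewrite ?inE ?ffunE //= eS.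
  rewrite (_ : _ / _ = d_e R (ECube k)); last first.
    by rewrite /d_e -card_blue_edges kS.
  by apply: le_bigmax_cond; apply/asboolP; rewrite FH kS.
apply: bigmax_le => [|k /asboolP]; first exact: bigmax_ge_id.
rewrite FH => noemb.
pose S : presub (Q n) := (finset.setT, blue_edges k).
have sS : is_subgraph S by rewrite /is_subgraph blue_edges_sub finset.subsetT.
have SP : is_subgraph S && `[< gfree (eq H) (subgraph S) >].
  by rewrite sS /=; apply/asboolP; rewrite gfree_embeds.
rewrite /d_e -card_blue_edges.
exact: (@le_bigmax_cond _ _ _ 0 S
  (fun T => is_subgraph T && `[< gfree (eq H) (subgraph T) >])
  (fun T : presub (Q n) => #|T.2|%:R / #|edges (Q n)|%:R : R) SP).
Qed.

(* The hypothesis [0 <= a] covers divergent sequences, whose [limn] is [0]. *)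
Lemma limn_le_decay (R : realType) (u : nat -> R) (a : R) (C : nat) : 0 <= a ->
  (forall n, (2 < n)%N -> u n <= a + C%:R / (n - 2)%:R) -> limn u <= a.
Proof.
move=> a0 ua; have [cu|ncu] := pselect (cvgn u); last by rewrite (dvgP ncu).
apply/ler_addgt0Pr => e e0; apply: limr_le => //.
(* Beyond [N + 3] the error C / (n - 2) is below [e]. *)
pose N := Num.bound (C%:R / e); exists (N + 3)%N => //= n Nn.
have n2 : (2 < n)%N by apply: leq_trans Nn; rewrite addnC leq_addr.
apply: le_trans (ua n n2) _; rewrite lerD2l ler_pdivrMr ?ltr0n ?subn_gt0 //.
rewrite -ler_pdivrMl // mulrC; apply/ltW/(lt_le_trans (archi_boundP _)).
  by rewrite divr_ge0 // ltW.
by rewrite ler_nat leq_subRL 1?ltnW // addnC -addnS.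
Qed.

(** Both double counts carry a factor 2: the sum is twice the number of blue edges and n 2^n is
    twice the number of edges. Dividing leaves p / q + C / (n - 2). *)
Lemma pi_ce_le (R : realType) (F : set ecube) (p q C : nat) : (0 < q)%N ->
  (forall n (k : {ffun edge (Q n) -> bool}), (2 < n)%N -> cfree F (ECube k) ->
    (q * (\sum_d \sum_v has_edge (blue_edges k) v d) * (n - 2) <=
     p * (n * #|Q n|) * (n - 2) + q * C * (n * #|Q n|))%N) ->
  pi_ce R F <= p%:R / q%:R.
Proof.
move=> q0 bound; apply: (@limn_le_decay _ _ _ C) => [|n n2]; first exact: divr_ge0.
apply: bigmax_le => [|k /asboolP Fk].
  by rewrite addr_ge0 // divr_ge0.
have := bound n k n2 Fk.
rewrite sum_has_edge ?blue_edges_sub // card_ord -card_edges_cube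
  /d_e -card_blue_edges /=.
set b := #|_|; set m := #|_| => le.
have m0 : (0 < m)%N.
  by rewrite -(ltn_pmul2l (m := 2)) // card_edges_cube muln_gt0 expn_gt0 (leq_trans _ n2).
have n20 : (0 < n - 2)%N by rewrite subn_gt0.
move: (n - 2)%N n20 le => l l0 le.
rewrite ler_pdivrMr ?ltr0n // mulrDl.
have -> : p%:R / q%:R * m%:R + C%:R / l%:R * m%:R =
    (p * m * l + q * C * m)%:R / (q * l)%:R :> R.
  by rewrite natrD !natrM; field; rewrite !pnatr_eq0 -!lt0n q0 l0.
rewrite ler_pdivlMr ?ltr0n ?muln_gt0 ?q0 // -natrM ler_nat.
by rewrite -(leq_pmul2l (m := 2)) //; move: le; congr (_ <= _)%N; ring.
Qed.

Theorem theorem2 (R : realType) :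
  (pi_e R (eq (Q 2)) = pi_ce R [set B]%classic /\
   pi_ce R [set B]%classic <= 1517%:R / 2500%:R (* 0.60680 *)) /\
  (pi_e R (eq C6) = pi_ce R [set B1; B2]%classic /\
   pi_ce R [set B1; B2]%classic <= 751%:R / 2000%:R (* 0.37550 *)).
Proof.
split; split.
- congr (limn _); apply/funext => n; apply: ex_density_eq => [x|k].
    by exists (flip ord0 x); apply: adj_flip.
  exact: cfree_square.
- apply: (@pi_ce_le _ _ 1517 2500 2) => // n k n2 /cfree_square noemb.
  apply: no_square_bound n2 (embeds_square noemb).
  + exact: flipK.
  + exact: flipC.
  + by move=> d v; apply: has_edge_flip.
- congr (limn _); apply/funext => n; apply: ex_density_eq => [x|k].
    by exists (ordS x); apply/orP; left.
  exact: cfree_hexagon.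
- apply: (@pi_ce_le _ _ 751 2000 16) => // n k n2 /cfree_hexagon noemb.
  apply: no_hexagon_bound n2 (embeds_no_hexagon noemb).
  + exact: flipK.
  + exact: flipC.
  + by move=> d v; apply: has_edge_flip.
Qed.
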